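(* Let $R=\{r_1,\dots,r_m\}$ be a set of $m$ words of length $\ell$, each one obtained by successively concatenating randomly chosen letters from $A^{\pm1}=\{a_1^{\pm1},\dots,a_n^{\pm1}\}$ with uniform probability. Then $M(A,R)$ has full rank, i.e. $\operatorname{rank}(M(A,R))=\min\{n,m\}$, asymptotically almost surely as $\ell\to\infty$.
   Context: $n,m\ge 1$ are fixed, and all letters (within a word and across the $m$ words) are chosen independently and uniformly from the $2n$ letters of $A^{\pm1}$. $M(A,R)$ is the $m\times n$ integer matrix whose $(i,j)$ entry is the sum of the exponents of all occurrences of $a_j$ in $r_i$. A property holds asymptotically almost surely as $\ell\to\infty$ if the probability that it holds tends to $1$ as $\ell\to\infty$. *)

(* Defs.v *)
From HB Require Import structures.
From mathcomp Require Import all_boot all_order all_algebra.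
From mathcomp Require Import all_classical all_reals all_analysis.

Set Implicit Arguments.
Unset Strict Implicit.
Unset Printing Implicit Defensive.

Import Order.TTheory GRing.Theory Num.Theory.
Import numFieldNormedType.Exports.

Local Open Scope classical_set_scope.
Local Open Scope ring_scope.

(* [(j, b)] stands for a_j if [b = false] and for a_j^-1 if [b = true]. *)
Definition letter (n : nat) : finType := ('I_n * bool)%type.

Definition expo (n : nat) (x : letter n) : int := (-1) ^+ x.2.

(* Words are not freely reduced; the m words are indexed and may coincide. *)
Definition words (n m l : nat) : finType := {ffun 'I_m -> l.-tuple (letter n)}.

Definition exponent_matrix (n m l : nat) (r : words n m l) : 'M[int]_(m, n) :=
  \matrix_(i < m, j < n) \sum_(x <- r i | x.1 == j) expo x.

(* The rank of an integer matrix is taken over the field of fractions of int. *)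
Definition rank_int (m n : nat) (M : 'M[int]_(m, n)) : nat :=
  \rank (map_mx (intr : int -> rat) M).

Definition letter_prob (R : realType) (n : nat) (x : letter n) : R :=
  (2 * n)%:R^-1.

(* Independence of the m * l letters: the law is the product of their laws. *)
Definition words_prob (R : realType) (n m l : nat) (r : words n m l) : R :=
  \prod_(i < m) \prod_(k < l) letter_prob R (tnth (r i) k).

Definition Pr (R : realType) (n m l : nat) (E : {set words n m l}) : R :=
  \sum_(r in E) words_prob R r.

Definition aas (R : realType) (n m : nat)
    (E : forall l : nat, {set words n m l}) : Prop :=
  Pr R (E l) @[l --> \oo] --> (1 : R).

(* Main.v *)
Require Import Defs.
From HB Require Import structures.
From mathcomp Require Import all_boot all_order all_algebra.
From mathcomp Require Import all_classical all_reals all_analysis.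
From mathcomp Require Import ring lra.

Set Implicit Arguments.
Unset Strict Implicit.
Unset Printing Implicit Defensive.

Import Order.TTheory GRing.Theory Num.Theory.
Import numFieldNormedType.Exports.

(** The matrix fails to have full rank only if its first [k = minn n m] rows
are linearly dependent, that is, if some row [i] among them lies in the span of
the [k - 1] others.  These others span a proper subspace of the [n]-dimensional
space, so they are all orthogonal to a nonzero vector [v] that is computed from
them alone, and a dependency forces row [i] to be orthogonal to [v] as well
([rank_deficient_normal]).  Word [i] is independent of the other words, so [v]
may be held fixed while word [i] is resampled ([card_le_resample]), and it
remains to bound the probability that the exponent vector of one random word
lies on the hyperplane [v^T x = 0], uniformly in [v] because [v] depends on [l]
and on the other words.

This bound is a Fourier estimate ([card_hyperplane_le]).  For real frequencies
[f 0, ..., f (K - 1)] the squared modulus of the sum of the [exp (i f_k w)] is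
nonnegative, and it equals [K ^ 2] when [w = 0]; hence the probability that
[w = 0] is at most the average over [k, k'] of the expectation of
[cos ((f k - f k') w)].  When [w] is the [v]-displacement of a word of [l]
independent letters with symmetric law, that expectation is the [l]-th power of
the mean of [cos ((f k - f k') v_j)] over [j].  Choosing [f k = k / (K v_j)] for
one [j] with [v_j != 0] puts the [j]-th angle at [(k - k') / K], which keeps the
mean at distance at least [(1 - cos (1 / K)) / n] from [1] and [-1] off the
diagonal, whatever the other coordinates of [v] are.  The diagonal contributes
[1 / K], so the probability is at most [1 / K + rho ^ l] with [rho < 1] depending
on [n] and [K] only.  A union bound over [i], then [K] large, then [l] large,
gives the claim. *)

Local Open Scope ring_scope.

(** * Cosine sums over random words *)

Definition displacement (R : realType) (n : nat) (v : 'I_n -> R)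
    (s : seq (letter n)) : R :=
  \sum_(x <- s) (expo x)%:~R * v x.1.

Lemma displacement_cons (R : realType) (n : nat) (v : 'I_n -> R) x s :
  displacement v (x :: s) = (expo x)%:~R * v x.1 + displacement v s.
Proof. by rewrite /displacement big_cons. Qed.

(** The letters [a_j] and [a_j^-1] are equally likely, so the sine terms of the
addition formula cancel in pairs; this keeps the Fourier computation within the
real cosine, without complex exponentials. *)
Lemma sum_letter_cosD (R : realType) (n : nat) (b : 'I_n -> R) (a : R) :
  \sum_(x : letter n) cos (a + (expo x)%:~R * b x.1) =
  cos a * \sum_(x : letter n) cos (b x.1).
Proof.
rewrite mulr_sumr.
rewrite -(pair_bigA _ (fun i c => cos (a + (expo ((i, c) : letter n))%:~R * b i))).
rewrite -(pair_bigA _ (fun i (c : bool) => cos a * cos (b i))) /=.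
apply: eq_bigr => i _; rewrite !big_bool /expo /= expr1 expr0.
rewrite mulrN1z mulr1z mulN1r mul1r cosB cosD; ring.
Qed.

Lemma sum_tuple_cons (R : nmodType) (T : finType) l (F : l.+1.-tuple T -> R) :
  \sum_t F t = \sum_(x : T) \sum_(t : l.-tuple T) F [tuple of x :: t].
Proof.
rewrite pair_big /=.
rewrite (reindex (fun p : T * l.-tuple T => [tuple of p.1 :: p.2])) //=.
exists (fun t : l.+1.-tuple T => (thead t, [tuple of behead t])).
  by move=> [x t] _ /=; rewrite theadE; congr (_, _); apply: val_inj.
by move=> t _ /=; rewrite -tuple_eta.
Qed.

(** The letters of a word are independent, so the characteristic function of the
displacement factors.  The induction carries a phase [a], which absorbs the
letters already processed. *)
Lemma sum_words_cos (R : realType) (n l : nat) (v : 'I_n -> R) (th : R) :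
  \sum_(t : l.-tuple (letter n)) cos (th * displacement v t) =
  (\sum_(x : letter n) cos (th * v x.1)) ^+ l.
Proof.
suff H a : \sum_(t : l.-tuple (letter n)) cos (a + th * displacement v t) =
  cos a * (\sum_(x : letter n) cos (th * v x.1)) ^+ l.
  under eq_bigr do rewrite -[_ * _]add0r.
  by rewrite H cos0 mul1r.
elim: l a => [|l IH] a.
  rewrite (big_pred1 [tuple]) => [|t]; last by apply/esym/eqP; exact: tuple0.
  by rewrite /displacement big_nil mulr0 addr0 mulr1.
rewrite sum_tuple_cons.
transitivity (\sum_(x : letter n) cos (a + (expo x)%:~R * (th * v x.1)) *
   (\sum_(x : letter n) cos (th * v x.1)) ^+ l).
  apply: eq_bigr => x _; rewrite -IH; apply: eq_bigr => t _.
  by rewrite displacement_cons; congr cos; ring.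
by rewrite -mulr_suml (sum_letter_cosD (fun i => th * v i)) exprS mulrA.
Qed.

Lemma norm_sum_letter_cos (R : realType) (n : nat) (b : 'I_n -> R) (j : 'I_n) :
  `|\sum_(x : letter n) cos (b x.1)| <= 2 * (n%:R - 1 + `|cos (b j)|).
Proof.
rewrite -(pair_bigA _ (fun i (c : bool) => cos (b i))) /=.
under eq_bigr do rewrite big_bool /= -mulr2n -mulr_natl.
rewrite -mulr_sumr normrM ger0_norm // ler_pM2l ?ltr0n //.
rewrite (bigD1 j) //= addrC; apply: le_trans (ler_normD _ _) _.
rewrite lerD2r; apply: le_trans (ler_norm_sum _ _ _) _.
apply: (@le_trans _ _ (\sum_(i < n | i != j) (1 : R))).
  by apply: ler_sum => i _; exact: cos_max.
have := erefl (\sum_(i < n) (1 : R)).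
rewrite [RHS]sumr_const card_ord (bigD1 j) //= => <-.
by rewrite addrC addrK.
Qed.

(** * Words on a hyperplane are rare *)

(** The angle lies between [1 / K] and [1], where the cosine is nonnegative and
decreasing, so the smallest angle is the worst. *)
Lemma norm_cos_frac (R : realType) (K d : nat) :
  (0 < d < K)%N -> `|cos (d%:R / K%:R : R)| <= cos (K%:R^-1).
Proof.
move=> /andP[d0 dK]; have K0 : 0 < K%:R :> R by rewrite ltr0n (leq_trans _ dK).
have p1 := @pihalf_ge1 R; have p2 := @pi_ge2 R.
have dK1 : d%:R / K%:R <= 1 :> R by rewrite ler_pdivrMr // mul1r ler_nat ltnW.
have dKge : K%:R^-1 <= d%:R / K%:R :> R.
  by rewrite ler_pdivlMr // mulVf ?gt_eqF // ler1n.
have iK0 : 0 < K%:R^-1 :> R by rewrite invr_gt0.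
rewrite ger0_norm; last by apply: cos_ge0_pihalf; apply/andP; split; lra.
by rewrite leNgt ltr_cos ?in_itv /= -?leNgt //; apply/andP; split; lra.
Qed.

(** Bounds the modulus of the characteristic function of one letter at the
nonzero frequency differences: at worst, [n - 1] coordinates contribute [1] and
the remaining one contributes [cos (1 / K)]. *)
Definition decay (R : realType) (n K : nat) : R :=
  1 - (1 - cos (K%:R^-1)) / n%:R.

Lemma decay_bounds (R : realType) (n K : nat) :
  (0 < n)%N -> (0 < K)%N -> 0 <= decay R n K < 1.
Proof.
move=> n0 K0; have n1 : 1 <= n%:R :> R by rewrite ler1n.
have n0' : 0 < n%:R :> R by lra.
have p1 := @pihalf_ge1 R; have p2 := @pi_ge2 R.
have K1 : K%:R^-1 <= 1 :> R by rewrite invf_le1 ?ltr0n // ler1n.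
have iK0 : 0 < K%:R^-1 :> R by rewrite invr_gt0 ltr0n.
have c0 : 0 <= cos (K%:R^-1) :> R by apply: cos_ge0_pihalf; apply/andP; split; lra.
have c1 : cos (K%:R^-1) < 1 :> R.
  by rewrite -[ltRHS]cos0 ltr_cos ?in_itv /= ?lexx //; apply/andP; split; lra.
rewrite /decay subr_ge0 ler_pdivrMr // mul1r gtrBl divr_gt0 ?andbT ?subr_gt0 //.
lra.
Qed.

(** The estimate holds for every real [v != 0] with the same constants, because
the frequencies are scaled by [1 / v_j]. *)
Lemma card_hyperplane_le (R : realType) (n l K : nat) (v : 'I_n -> R) (j : 'I_n) :
  v j != 0 -> (0 < K)%N ->
  #|[set t : l.-tuple (letter n) | displacement v t == 0]|%:R <=
  (K%:R^-1 + decay R n K ^+ l) * ((2 * n) ^ l)%:R.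
Proof.
move=> vj K0; set Z := #|_|.
have KR : 0 < K%:R :> R by rewrite ltr0n.
have n0 : (0 < n)%N by case: n j {v vj Z} => [[]|].
have nR : 0 < n%:R :> R by rewrite ltr0n.
pose f (k : nat) : R := k%:R / (K%:R * v j).
pose S := \sum_(t : l.-tuple (letter n)) \sum_(k < K) \sum_(k' < K)
            cos ((f k - f k') * displacement v t).
have lowS : K%:R ^+ 2 * Z%:R <= S.
  rewrite /Z -sum1_card natr_sum mulr_sumr /S.
  rewrite [leRHS](bigID (fun t => t \in [set t : l.-tuple (letter n) |
    displacement v t == 0])) /= -[leLHS]addr0; apply: lerD.
    apply: ler_sum => t; rewrite inE => /eqP ->.
    under eq_bigr do under eq_bigr do rewrite mulr0 cos0.
    by rewrite !sumr_const card_ord -mulrnA mulr1 -natrX expnS expn1 lexx.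
  (* The double sum is the squared modulus of the sum of the exp (i f_k w). *)
  apply: sumr_ge0 => t _; set w := displacement v t.
  have -> : \sum_(k < K) \sum_(k' < K) cos ((f k - f k') * w) =
     (\sum_(k < K) cos (f k * w)) ^+ 2 + (\sum_(k < K) sin (f k * w)) ^+ 2.
    rewrite !expr2 !big_distrlr /= -big_split /=; apply: eq_bigr => k _.
    by rewrite -big_split /=; apply: eq_bigr => k' _; rewrite mulrBl cosB.
  by rewrite addr_ge0 // sqr_ge0.
have upS : S <= \sum_(k < K) \sum_(k' < K)
   ((k == k')%:R + decay R n K ^+ l) * ((2 * n) ^ l)%:R.
  rewrite /S exchange_big /=; apply: ler_sum => k _.
  rewrite exchange_big /=; apply: ler_sum => k' _.
  rewrite sum_words_cos; apply: le_trans (ler_norm _) _; rewrite normrX.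
  have /andP[d0 d1] := decay_bounds R n0 K0.
  have [<-|kk'] := eqVneq k k'.
    rewrite mulrDl mul1r ler_wpDr ?mulr_ge0 ?exprn_ge0 //.
    rewrite natrX lerXn2r ?nnegrE //.
    apply: le_trans (norm_sum_letter_cos (fun i => (f k - f k) * v i) j) _.
    by rewrite subrr mul0r cos0 normr1 natrM; lra.
  rewrite add0r natrX -exprMn lerXn2r ?nnegrE ?mulr_ge0 //.
  apply: le_trans (norm_sum_letter_cos (fun i => (f k - f k') * v i) j) _.
  have {kk'} : `|cos ((f k - f k') * v j)| <= cos (K%:R^-1).
    wlog kk : k k' kk' / (k' < k)%N.
      move=> H; have [?|] := ltnP k' k; first exact: H.
      rewrite leq_eqVlt => /orP[/eqP /val_inj/eqP|]; first by rewrite (negPf kk').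
      by rewrite -cosN -mulNr opprB; apply: H; rewrite eq_sym.
    have -> : (f k - f k') * v j = (k - k')%:R / K%:R.
      by rewrite /f natrB 1?ltnW //; field; rewrite vj gt_eqF.
    by rewrite norm_cos_frac // subn_gt0 kk (leq_ltn_trans (leq_subr _ _)).
  move=> H; apply: (@le_trans _ _ (2 * (n%:R - 1 + cos (K%:R^-1)))); first by lra.
  rewrite /decay natrM le_eqVlt; apply/orP; left; apply/eqP; field.
  by rewrite gt_eqF.
have {upS} := le_trans lowS upS.
have -> : \sum_(k < K) \sum_(k' < K)
   ((k == k')%:R + decay R n K ^+ l) * ((2 * n) ^ l)%:R =
   K%:R ^+ 2 * ((K%:R^-1 + decay R n K ^+ l) * ((2 * n) ^ l)%:R).
  under eq_bigr => k _.
    rewrite -mulr_suml big_split /= sumr_const card_ord (bigD1 k) //= eqxx.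
    rewrite big1 ?addr0; last by move=> i ik; rewrite eq_sym (negPf ik).
    over.
  rewrite sumr_const card_ord -mulr_natl mulr1n -[decay _ _ _ ^+ l *+ K]mulr_natl.
  by field; rewrite gt_eqF.
by rewrite ler_pM2l // exprn_gt0.
Qed.

(** * Resampling one word *)

Definition resample (I T : finType) (i : I) (r : {ffun I -> T}) (t : T) :
  {ffun I -> T} := [ffun k => if k == i then t else r k].

(** Exchanging the old and the new value at [i] is an involution on the pairs
(family, new value), which turns a pair whose resampling lies in [E] into a pair
whose first component lies in [E]. *)
Lemma card_resample (I T : finType) (i : I) (E : {set {ffun I -> T}}) :
  (\sum_(r : {ffun I -> T}) #|[set t | resample i r t \in E]| = #|T| * #|E|)%N.
Proof.
pose h (p : {ffun I -> T} * T) := (resample i p.1 p.2, p.1 i).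
have hK : involutive h.
  move=> [r t]; rewrite /h /=; congr (_, _); last by rewrite ffunE eqxx.
  by apply/ffunP => k; rewrite !ffunE; case: eqP => [->|].
transitivity (\sum_(p : {ffun I -> T} * T) (resample i p.1 p.2 \in E))%N.
  rewrite -(pair_bigA _ (fun r t => (resample i r t \in E) : nat)) /=.
  apply: eq_bigr => r _; rewrite -sum1_card big_mkcond.
  by apply: eq_bigr => t _; rewrite inE; case: (_ \in _).
rewrite (reindex_inj (inv_inj hK)) /=.
transitivity (\sum_(p : {ffun I -> T} * T) (p.1 \in E))%N.
  by apply: eq_bigr => p _; rewrite -[in RHS](hK p).
rewrite -(pair_bigA _ (fun r (_ : T) => (r \in E) : nat)) /=.
under eq_bigr do rewrite sum_nat_const.
rewrite -big_distrr /=; congr (_ * _)%N; rewrite -sum1_card [RHS]big_mkcond /=.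
by apply: eq_bigr => r _; case: (_ \in _).
Qed.

(** Conditioning on all the coordinates except [i], for the uniform law: a bound
on each conditional probability is a bound on the probability. *)
Lemma card_le_resample (R : numDomainType) (I T : finType) (i : I)
    (E : {set {ffun I -> T}}) (c : R) :
  (0 < #|T|)%N ->
  (forall r, #|[set t | resample i r t \in E]|%:R <= c * #|T|%:R) ->
  #|E|%:R <= c * #|{ffun I -> T}|%:R.
Proof.
move=> T0 H; have TR : 0 < #|T|%:R :> R by rewrite ltr0n.
rewrite -(ler_pM2l TR) -natrM -(card_resample i) natr_sum.
apply: le_trans (ler_sum _ (fun r _ => H r)) _.
by rewrite sumr_const -[_ *+ _]mulr_natr (mulrC c) -mulrA.
Qed.

(** * Rank deficiency *)

(** An explicit function of [B], so that the vector attached to the other rows is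
literally unchanged when one row is resampled. *)
Definition normal_vector (F : fieldType) (p n : nat) (B : 'M[F]_(p, n)) :
  'cV[F]_n := (nz_row (kermx B^T))^T.

Lemma mulmx_normal_vector (F : fieldType) (p n : nat) (B : 'M[F]_(p, n)) :
  B *m normal_vector B = 0.
Proof.
apply: trmx_inj; rewrite trmx_mul trmxK trmx0.
by apply/sub_kermxP; exact: nz_row_sub.
Qed.

Lemma normal_vector_neq0 (F : fieldType) (p n : nat) (B : 'M[F]_(p, n)) :
  (p < n)%N -> normal_vector B != 0.
Proof.
move=> pn; rewrite -trmx0 (inj_eq trmx_inj) nz_row_eq0 kermx_eq0 /row_free.
by rewrite mxrank_tr ltn_eqF // (leq_ltn_trans (rank_leq_row B)).
Qed.

(** If [u *m A = 0] with [u i != 0], multiplying by a vector orthogonal to the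
rows other than [i] leaves only [u i] times the product with row [i]. *)
Lemma rank_deficient_normal (F : fieldType) (k n : nat) (A : 'M[F]_(k, n)) :
  (\rank A < k)%N ->
  exists i, (A *m normal_vector (row' i A)) i 0 = 0.
Proof.
move=> rk; have : kermx A != 0 by rewrite kermx_eq0 /row_free ltn_eqF.
case/rowV0Pn=> u /sub_kermxP uA0 /rV0Pn[i ui]; exists i.
set v := normal_vector _.
have : (u *m A *m v) 0 0 = 0 by rewrite uA0 mul0mx mxE.
rewrite -mulmxA mxE (bigD1 i) //= big1 ?addr0.
  by move/eqP; rewrite mulf_eq0 (negPf ui) => /eqP.
move=> i' i'i; have [i'' ->] : exists i'', i' = lift i i''.
  by case: (unliftP i i') i'i => [j -> _|->]; [exists j|rewrite eqxx].
have /matrixP/(_ i'' 0) : row' i A *m v = 0 by exact: mulmx_normal_vector.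
rewrite !mxE => H; rewrite -[RHS](mulr0 (u 0 (lift i i''))) -[in RHS]H.
by congr (_ * _); apply: eq_bigr => j _; rewrite [in RHS]mxE.
Qed.

(** * The probability of rank deficiency *)

(** Taking [minn n m] rows treats [m <= n] and [n < m] at once: dependency of
these rows is necessary for a rank defect.  The entries are read in [R], where
the cosine estimate takes place; the rank is the same as over [rat]. *)
Definition top_rows (R : realType) (n m l : nat) (r : words n m l) :
    'M[R]_(minn n m, n) :=
  rowsub (widen_ord (geq_minr n m)) (map_mx (intr : int -> R) (exponent_matrix r)).

Lemma rank_top_rows_le (R : realType) (n m l : nat) (r : words n m l) :
  (\rank (top_rows R r) <= rank_int (exponent_matrix r))%N.
Proof.
apply: leq_trans (mxrankS (rowsub_sub _ _)) _.
rewrite /rank_int -(mxrank_map (ratr : rat -> R)) -map_mx_comp.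
have -> // : map_mx (ratr \o intr) (exponent_matrix r) =
  map_mx (intr : int -> R) (exponent_matrix r).
by apply: eq_map_mx => z; rewrite /= ratr_int.
Qed.

Lemma top_rows_mulE (R : realType) (n m l : nat) (r : words n m l)
    (v : 'cV[R]_n) (i : 'I_(minn n m)) :
  (top_rows R r *m v) i 0 =
  displacement (fun j => v j 0) (r (widen_ord (geq_minr n m) i)).
Proof.
rewrite mxE /displacement (partition_big (fun x : letter n => x.1) predT) //=.
apply: eq_bigr => j _; rewrite !mxE rmorph_sum mulr_suml /=.
by apply: eq_bigr => x /eqP ->.
Qed.

Lemma row'_top_rows_resample (R : realType) (n m l : nat) (r : words n m l)
    (i : 'I_(minn n m)) (t : l.-tuple (letter n)) :
  row' i (top_rows R (resample (widen_ord (geq_minr n m) i) r t)) =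
  row' i (top_rows R r).
Proof.
apply/matrixP => i' j; rewrite !mxE /= ffunE.
by rewrite -val_eqE /= -[_ == _ :> nat]/(lift i i' == i) eq_sym (negPf (neq_lift _ _)).
Qed.

Lemma card_words (n m l : nat) : #|words n m l| = ((2 * n) ^ (l * m))%N.
Proof.
rewrite card_ffun card_tuple card_prod card_ord card_bool card_ord mulnC.
by rewrite expnM.
Qed.

Lemma PrE (R : realType) (n m l : nat) (E : {set words n m l}) :
  Pr R E = #|E|%:R / #|words n m l|%:R.
Proof.
rewrite /Pr -sum1_card natr_sum mulr_suml; apply: eq_bigr => r _.
rewrite /words_prob /letter_prob mul1r card_words.
under eq_bigr do rewrite prodr_const card_ord.
by rewrite prodr_const card_ord -exprM natrX exprVn.
Qed.

Lemma Pr_setC (R : realType) (n m l : nat) (E : {set words n m l}) :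
  (0 < n)%N -> Pr R E = 1 - Pr R (~: E).
Proof.
move=> n0; rewrite !PrE -(cardsC E) natrD.
have : #|E|%:R + #|~: E|%:R != 0 :> R.
  by rewrite -natrD cardsC card_words pnatr_eq0 -lt0n expn_gt0 muln_gt0 n0.
by move=> ?; field.
Qed.

(** The event that row [i] is orthogonal to the vector chosen from the other rows
is a hyperplane event for word [i] alone once the other words are fixed; the
union over [i] of these events contains the rank defect. *)
Lemma Pr_deficient_le (R : realType) (n m l K : nat) :
  (0 < n)%N -> (0 < K)%N ->
  Pr R [set r : words n m l | rank_int (exponent_matrix r) != minn n m] <=
  (minn n m)%:R * (K%:R^-1 + decay R n K ^+ l).
Proof.
move=> n0 K0; set k := minn n m; set c := _ + _.
pose bad (i : 'I_k) := [set r : words n m l |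
  (top_rows R r *m normal_vector (row' i (top_rows R r))) i 0 == 0].
have N0 : (0 < #|words n m l|)%N by rewrite card_words expn_gt0 muln_gt0 n0.
have cards_bad i : #|bad i|%:R <= c * #|words n m l|%:R.
  apply: (card_le_resample (i := widen_ord (geq_minr n m) i)) => [|r].
    by rewrite card_tuple card_prod card_bool card_ord expn_gt0 muln_gt0 n0.
  set v := normal_vector (row' i (top_rows R r)).
  have /cV0Pn[j vj] : v != 0.
    apply: normal_vector_neq0; rewrite prednK ?(leq_ltn_trans _ (ltn_ord i)) //.
    exact: geq_minl.
  have := card_hyperplane_le l (v := fun j => v j 0) vj K0.
  rewrite card_tuple card_prod card_bool card_ord mulnC; apply: le_trans.
  rewrite ler_nat; apply/subset_leq_card/fintype.subsetP => t; rewrite !inE.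
  by rewrite row'_top_rows_resample top_rows_mulE ffunE eqxx.
rewrite PrE ler_pdivrMr ?ltr0n // -mulrA.
apply: (@le_trans _ _ (\sum_(i < k) #|bad i|%:R)); last first.
  rewrite -[k in k%:R]card_ord mulr_natl -sumr_const.
  by apply: ler_sum => i _; exact: cards_bad.
rewrite -natr_sum ler_nat.
apply: (@leq_trans #|\bigcup_(i < k) bad i|); last first.
  elim/big_rec2: _ => [|i A b _ le_bA]; first by rewrite cards0.
  by apply: leq_trans (leq_card_setU _ _) _; rewrite leq_add2l.
apply/subset_leq_card/fintype.subsetP => r; rewrite inE => rk.
have [|i ri] := @rank_deficient_normal _ _ _ (top_rows R r).
  apply: leq_ltn_trans (rank_top_rows_le R r) _; rewrite ltn_neqAle rk /=.
  by rewrite leq_min rank_leq_col rank_leq_row.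
by apply/bigcupP; exists i; rewrite // inE ri.
Qed.

Lemma near_Pr_deficient_le (R : realType) (n m : nat) (e : R) :
  (0 < n)%N -> 0 < e ->
  (\forall l \near \oo,
    Pr R [set r : words n m l | rank_int (exponent_matrix r) != minn n m]
      <= e)%classic.
Proof.
move=> n0 e0; set k := minn n m.
(* The error is at most k / K + k * decay ^ l; K makes the first term <= e / 2. *)
pose K := (Num.bound (2 * k%:R / e)).+1.
have K0 : (0 < K)%N by [].
have KR : 0 < K%:R :> R by rewrite ltr0n.
have kK : k%:R / K%:R <= e / 2 :> R.
  rewrite ler_pdivrMr //.
  have : 2 * k%:R / e < K%:R.
    apply: lt_trans (archi_boundP _) _; last by rewrite ltr_nat.
    by rewrite divr_ge0 // ltW.
  by rewrite ltr_pdivrMr // => H; lra.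
have /andP[d0 d1] := decay_bounds R n0 K0.
have : (k%:R * decay R n K ^+ l @[l --> \oo] --> k%:R * (0 : R))%classic.
  by apply: cvgMr; apply: cvg_expr; rewrite ger0_norm.
rewrite mulr0 => /cvgrPdist_le /(_ (e / 2)) H.
have {}H := H (divr_gt0 e0 (ltr0Sn _ 1)).
near=> l; apply: le_trans (Pr_deficient_le R m l n0 K0) _.
have : `|0 - k%:R * decay R n K ^+ l| <= e / 2 by near: l.
rewrite sub0r normrN ger0_norm ?mulr_ge0 ?exprn_ge0 // mulrDr -/k => ?.
by move: kK => ?; lra.
Unshelve. all: by end_near.
Qed.

Local Close Scope ring_scope.

Theorem theorem5p1 (R : realType) (n m : nat) (hn : 0 < n) (hm : 0 < m) :
  aas R (fun l : nat =>
    [set r : words n m l | rank_int (exponent_matrix r) == minn n m]%SET).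
Proof.
apply/cvgrPdist_le => e e0.
apply: filterS (near_Pr_deficient_le m hn e0) => l deficient_le.
rewrite Pr_setC // opprB addrC subrK ger0_norm; last by rewrite PrE divr_ge0.
apply: le_trans deficient_le; rewrite le_eqVlt; apply/orP; left.
by apply/eqP; congr Pr; apply/setP => r; rewrite !inE.
Qed.
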